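(* Let $G$ be a finite group, $d\ge1$ an integer, and $g:G\to\mathbb{D}(d)$ a fixed function. The property, for functions $f:G\to\mathbb{D}(d)$, of being unitarily equivalent to $g$ (that is, there is $U\in U(d)$ with $f(x)=Ug(x)U^{-1}$ for all $x\in G$) has a tester with query complexity $(d^{3/2}/\epsilon)^{O(d^2)}$, where the constant in the $O(\cdot)$ does not depend on $G$.
   Context: $\mathbb{D}(d)=\{A\in M_d(\mathbb{C}): \|A\|_F\le 1\}$, where $\|\cdot\|_F$ is the Frobenius norm; $U(d)$ is the group of $d\times d$ complex unitary matrices. For $f,h:G\to\mathbb{D}(d)$, $\mathrm{dist}(f,h)=\frac12\sqrt{\mathbf{E}_{x\in G}\|f(x)-h(x)\|_F^2}$ ($x$ uniform in $G$). A function $f$ is $\epsilon$-far from a property $\mathcal{P}$ if $\mathrm{dist}(f,h)\ge\epsilon$ for every $h:G\to\mathbb{D}(d)$ satisfying $\mathcal{P}$. A tester for $\mathcal{P}$ is a randomized algorithm that, given $\epsilon>0$ and query access to $f$ (and full knowledge of $g$; it may sample uniform elements of $G$ and perform group operations), accepts with probability at least $2/3$ if $f$ satisfies $\mathcal{P}$ and rejects with probability at least $2/3$ if $f$ is $\epsilon$-far from $\mathcal{P}$. The query complexity is the number of queries to $f$. *)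

(* Defs.v *)
From HB Require Import structures.
From mathcomp Require Import all_boot all_order all_algebra all_fingroup.
From mathcomp Require Import spectral complex.
From mathcomp Require Import reals exp.

Set Implicit Arguments.
Unset Strict Implicit.
Unset Printing Implicit Defensive.

Import Order.TTheory GRing.Theory Num.Theory.
Local Open Scope ring_scope.

Section Frobenius.
Variables (R : realType) (d : nat).

(* [normc] is the real-valued modulus on [R[i]]. *)
Definition frobenius (A : 'M[R[i]]_d) : R :=
  Num.sqrt (\sum_(i < d) \sum_(j < d) ComplexField.Normc.normc (A i j) ^+ 2).

Record frobball :=
  Frobball { frobball_mx :> 'M[R[i]]_d; _ : frobenius frobball_mx <= 1 }.

HB.instance Definition _ := [isSub for frobball_mx].

End Frobenius.

Section Distance.
Variables (R : realType) (d : nat) (gT : finGroupType).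
Implicit Types f g h : gT -> frobball R d.

Definition dist f h : R :=
  2^-1 * Num.sqrt
    (#|gT|%:R^-1 * \sum_(x : gT) frobenius (\val (f x) - \val (h x)) ^+ 2).

Definition far (eps : R) f (P : (gT -> frobball R d) -> Prop) : Prop :=
  forall h, P h -> eps <= dist f h.

Definition unitarily_equivalent g f : Prop :=
  exists2 U : 'M[R[i]]_d, U \is unitarymx &
    forall x, f x = U *m g x *m invmx U :> 'M[R[i]]_d.

End Distance.

Section Algorithms.
Variables (R : realType) (d : nat) (gT : finGroupType).
Implicit Types f : gT -> frobball R d.

(* Randomized, adaptive query algorithms as decision trees. The continuations
   are arbitrary functions: computation between queries is free, including
   group operations and any use of data fixed beforehand. A tree is
   well-founded, so every run halts. *)
Inductive query_algorithm : Type :=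
| Output of bool  (* [true] accepts, [false] rejects *)
| Flip of (bool -> query_algorithm)
| Sample of (gT -> query_algorithm)
| Query of gT & (frobball R d -> query_algorithm).

(* Probability that the run of [T] on oracle [f] outputs [b]; the draws at
   [Flip] and [Sample] nodes are uniform and mutually independent. *)
Fixpoint prob_output f (T : query_algorithm) (b : bool) : R :=
  match T with
  | Output c => (c == b)%:R
  | Flip k => 2^-1 * \sum_(c : bool) prob_output f (k c) b
  | Sample k => #|gT|%:R^-1 * \sum_(x : gT) prob_output f (k x) b
  | Query x k => prob_output f (k (f x)) b
  end.

(* Number of queries to [f], in the worst case over the random draws. *)
Fixpoint num_queries f (T : query_algorithm) : nat :=
  match T with
  | Output _ => 0
  | Flip k => \max_(c : bool) num_queries f (k c)
  | Sample k => \max_(x : gT) num_queries f (k x)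
  | Query x k => (num_queries f (k (f x))).+1
  end.

Definition is_tester (P : (gT -> frobball R d) -> Prop)
    (T : R -> query_algorithm) : Prop :=
  forall eps : R, 0 < eps ->
    (forall f, P f -> 2 / 3 <= prob_output f (T eps) true) /\
    (forall f, far eps f P -> 2 / 3 <= prob_output f (T eps) false).

Definition query_complexity_le (T : R -> query_algorithm) (q : R -> R) : Prop :=
  forall eps : R, 0 < eps -> forall f, (num_queries f (T eps))%:R <= q eps.

End Algorithms.

(* Main.v *)
(* The tester draws n uniform points, queries f there, and accepts iff a single
   unitary U explains all the answers, i.e. f(x) = U g(x) U^-1 at every sample.
   It never rejects a conjugate of g. For soundness, cover U(d) by a finite net
   of (d/eps)^O(d^2) unitaries V such that every conjugate of g is uniformly
   eps-close to some V g V^-1. If f is eps-far, then for each V of the net f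
   stays within eps of V g V^-1 on at most a 1 - 3 eps^2/4 fraction of the
   points, so by a union bound over the net n = O(|net|/eps^2) samples suffice.
   The bound on the number of queries tends to 1 when d = 1 and eps -> 1; in
   dimension 1 conjugation is trivial and the net is a single point. *)

Require Import Defs.
From mathcomp Require Import all_boot all_order all_algebra all_fingroup.
From mathcomp Require Import spectral complex.
From mathcomp Require Import boolp reals exp.
From mathcomp Require Import ring lra.

Import Order.TTheory GRing.Theory Num.Theory.
Local Open Scope ring_scope.
Local Open Scope sesquilinear_scope.

Local Notation normc := ComplexField.Normc.normc.

(** * The Frobenius norm and its behaviour under unitary conjugation *)

Section FrobeniusTheory.
Variables (R : realType) (d : nat).
Implicit Types (A U V : 'M[R[i]]_d) (z : R[i]).

Lemma normc_ge0 z : 0 <= normc z.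
Proof. by case: z => a b; rewrite sqrtr_ge0. Qed.

Lemma normc_sqrE z : normc z ^+ 2 = complex.Re z ^+ 2 + complex.Im z ^+ 2.
Proof. by case: z => a b /=; rewrite sqr_sqrtr // addr_ge0 ?sqr_ge0. Qed.

Lemma normc_conjC z : normc (Num.conj z) = normc z.
Proof. by case: z => a b /=; rewrite sqrrN. Qed.

Lemma normc_le_Re_Im z : normc z <= `|complex.Re z| + `|complex.Im z|.
Proof.
rewrite -ler_sqr ?nnegrE ?normc_ge0 ?addr_ge0 // normc_sqrE sqrrD.
rewrite !real_normK ?num_real //.
by rewrite lerD2r lerDl mulrn_wge0 // mulr_ge0.
Qed.

Lemma normc_Re_le z : `|complex.Re z| <= normc z.
Proof.
rewrite -ler_sqr ?nnegrE ?normc_ge0 // normc_sqrE real_normK ?num_real //.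
by rewrite lerDl sqr_ge0.
Qed.

Lemma normc_Im_le z : `|complex.Im z| <= normc z.
Proof.
rewrite -ler_sqr ?nnegrE ?normc_ge0 // normc_sqrE real_normK ?num_real //.
by rewrite lerDr sqr_ge0.
Qed.

Lemma frobenius_ge0 A : 0 <= frobenius A.
Proof. exact: sqrtr_ge0. Qed.

Lemma frobenius_sqrE A :
  frobenius A ^+ 2 = \sum_(i < d) \sum_(j < d) normc (A i j) ^+ 2.
Proof.
rewrite sqr_sqrtr // sumr_ge0 // => i _.
by apply: sumr_ge0 => j _; exact: sqr_ge0.
Qed.

Lemma frobenius_sqr_trace A : (frobenius A ^+ 2)%:C%C = \tr (A *m A^t*).
Proof.
rewrite frobenius_sqrE rmorph_sum; apply: eq_bigr => i _.
rewrite rmorph_sum mxE; apply: eq_bigr => j _.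
by rewrite !mxE -normCK rmorphXn.
Qed.

Lemma normc_le_frobenius A i j : normc (A i j) <= frobenius A.
Proof.
rewrite -ler_sqr ?nnegrE ?normc_ge0 ?frobenius_ge0 // frobenius_sqrE.
rewrite (bigD1 i) //= (bigD1 j) //= -addrA lerDl addr_ge0 //.
  by apply: sumr_ge0 => k _; exact: sqr_ge0.
by apply: sumr_ge0 => k _; apply: sumr_ge0 => l _; exact: sqr_ge0.
Qed.

Lemma frobenius_le_entries A (c : R) :
  0 <= c -> (forall i j, normc (A i j) <= c) -> frobenius A <= d%:R * c.
Proof.
move=> c0 Ac; rewrite -ler_sqr ?nnegrE ?frobenius_ge0 ?mulr_ge0 // frobenius_sqrE.
have -> : (d%:R * c) ^+ 2 = \sum_(i < d) \sum_(j < d) c ^+ 2.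
  by rewrite !sumr_const !card_ord -mulrnA -[RHS]mulr_natl natrM exprMn -expr2.
by apply: ler_sum => i _; apply: ler_sum => j _; rewrite ler_sqr ?nnegrE ?normc_ge0.
Qed.

Lemma frobenius_sqr_sub_le A B :
  frobenius (A - B) ^+ 2 <= 2 * (frobenius A ^+ 2 + frobenius B ^+ 2).
Proof.
rewrite !frobenius_sqrE -big_split mulr_sumr; apply: ler_sum => i _ /=.
rewrite -big_split mulr_sumr; apply: ler_sum => j _ /=.
rewrite !mxE !normc_sqrE !raddfB /= .
set a := complex.Re (A i j); set b := complex.Im (A i j).
set a' := complex.Re (B i j); set b' := complex.Im (B i j).
have := sqr_ge0 (a + a'); have := sqr_ge0 (b + b'); nra.
Qed.

(** Through the trace form, the factors [U^t* U] cancel, the inner one directly and the outer one by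
    cyclicity of the trace. *)
Lemma frobenius_unitary_conj A U :
  U \is unitarymx -> frobenius (U *m A *m invmx U) = frobenius A.
Proof.
move=> Uu; apply/eqP; rewrite -(eqrXn2 (n := 2)) ?frobenius_ge0 //; apply/eqP.
apply: (@complexI R); rewrite !frobenius_sqr_trace invmx_unitary //.
rewrite !trmx_mul !map_mxM /= trmxCK -!mulmxA (mulmxA (U^t*)) -invmx_unitary //.
rewrite mulVmx ?unitarymx_unit // mul1mx mxtrace_mulC -!mulmxA.
by rewrite mulVmx ?unitarymx_unit // mulmx1.
Qed.

Lemma unitarymx_entry_le1 U i j : U \is unitarymx -> normc (U i j) <= 1.
Proof.
move=> /unitarymxP /matrixP /(_ i i); rewrite !mxE eqxx => UU.
have UU1 : \sum_k normc (U i k) ^+ 2 = 1.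
  apply: (@complexI R); rewrite rmorph_sum rmorph1 -[RHS]UU.
  by apply: eq_bigr => k _; rewrite !mxE -normCK rmorphXn.
rewrite -[leRHS]sqrtr1 -UU1 -[leLHS]ger0_norm ?normc_ge0 // -sqrtr_sqr ler_sqrt.
  by rewrite (bigD1 j) //= lerDl sumr_ge0 // => k _; exact: sqr_ge0.
by rewrite UU1.
Qed.

(** Each entry of the difference is a sum of [d ^ 2] terms, of modulus at most [2 c] because the
    entries of [A], [U] and [V] are bounded by 1. Passing from entries to the norm costs the third
    factor [d]. *)
Lemma frobenius_conj_dist A U V (c : R) :
    frobenius A <= 1 -> U \is unitarymx -> V \is unitarymx -> 0 <= c ->
    (forall i j, normc (U i j - V i j) <= c) ->
  frobenius (U *m A *m invmx U - V *m A *m invmx V) <= d%:R ^+ 3 * (c *+ 2).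
Proof.
move=> A1 Uu Vu c0 UV; rewrite !invmx_unitary //.
rewrite exprS -mulrA; apply: frobenius_le_entries => [|i j].
  by rewrite mulr_ge0 ?exprn_ge0 // mulrn_wge0.
(* Telescoping: [u u'^* - v v'^* = (u - v) u'^* + v (u' - v')^*]. *)
have -> : (U *m A *m U^t* - V *m A *m V^t*) i j =
    \sum_k \sum_l A l k *
      ((U i l - V i l) * Num.conj (U j k) + V i l * Num.conj (U j k - V j k)).
  rewrite !mxE -sumrB; apply: eq_bigr => k _.
  rewrite !mxE !mulr_suml -sumrB; apply: eq_bigr => l _.
  by rewrite rmorphB; ring.
have normc_sum (F : 'I_d -> R[i]) b :
    (forall k, normc (F k) <= b) -> normc (\sum_k F k) <= d%:R * b.
  move=> Fb; have -> : d%:R * b = \sum_(k < d) b.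
    by rewrite sumr_const card_ord mulr_natl.
  elim/big_ind2: _ => [|x1 x2 y1 y2 ? ?|k _]; last exact: Fb.
    by rewrite ComplexField.Normc.normc0.
  by rewrite (le_trans (le_normcD _ _)) // lerD.
rewrite expr2 -mulrA; apply: (normc_sum) => k; apply: (normc_sum) => l.
rewrite ComplexField.Normc.normcM -[leRHS]mul1r ler_pM ?normc_ge0 //.
  exact: le_trans (normc_le_frobenius _ _ _) A1.
rewrite (le_trans (le_normcD _ _)) // !ComplexField.Normc.normcM mulr2n.
rewrite !normc_conjC lerD //.
  by rewrite -[leRHS]mulr1 ler_pM ?normc_ge0 // unitarymx_entry_le1.
by rewrite -[leRHS]mul1r ler_pM ?normc_ge0 // unitarymx_entry_le1.
Qed.

Lemma unitarymx1 : (1%:M : 'M[R[i]]_d) \is unitarymx.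
Proof. by apply/unitarymxP; rewrite trmx1 map_mx1 mulmx1. Qed.

End FrobeniusTheory.

(** * The sampling test: completeness, and soundness by a union bound *)

Section ConsistencyTest.
Variables (R : realType) (d : nat) (gT : finGroupType).
Implicit Types (f g h : gT -> frobball R d) (s : seq (gT * frobball R d)).

Lemma card_finGroup_neq0 : #|gT|%:R != 0 :> R.
Proof. by rewrite pnatr_eq0 -lt0n -cardsT cardG_gt0. Qed.

Lemma mean_const (c : R) : #|gT|%:R^-1 * \sum_(x : gT) c = c.
Proof. by rewrite sumr_const -[X in _ * X]mulr_natl mulKf ?card_finGroup_neq0. Qed.

(** Turns an upper bound on acceptance into a lower bound on rejection. *)
Lemma prob_outputC f (T : query_algorithm R d gT) :
  prob_output f T true + prob_output f T false = 1.
Proof.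
elim: T => [[]|k IH|k IH|x k IH] /=; rewrite ?eqxx ?addr0 ?add0r //.
- rewrite -mulrDr -big_split (eq_bigr (fun=> 1)) => [|c _]; last exact: IH.
  by rewrite big_bool mulVf ?pnatr_eq0.
- by rewrite -mulrDr -big_split (eq_bigr (fun=> 1)) ?mean_const // => x _; exact: IH.
Qed.

Definition consistent g s : Prop :=
  exists2 U : 'M[R[i]]_d, U \is unitarymx &
    all (fun p => (\val p.2 : 'M[R[i]]_d) == U *m g p.1 *m invmx U) s.

(** The accumulator [s] records the answers. The final verdict is a classical decision, legitimate
    because computation between queries is free in this model. *)
Fixpoint consistency_test g (n : nat) s : query_algorithm R d gT :=
  if n is n'.+1 then
    Sample (fun x => Query x (fun y => consistency_test g n' ((x, y) :: s)))
  else Output R d gT `[< consistent g s >].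

Lemma num_queries_consistency_test f g n s :
  (num_queries f (consistency_test g n s) <= n)%N.
Proof. by elim: n s => [|n IH] s //=; apply/bigmax_leqP => x _; rewrite ltnS. Qed.

Lemma consistency_test_complete f g n :
  unitarily_equivalent g f -> prob_output f (consistency_test g n [::]) true = 1.
Proof.
case=> U Uu fU.
suff IH s : all (fun p => (\val p.2 : 'M[R[i]]_d) == U *m g p.1 *m invmx U) s ->
  prob_output f (consistency_test g n s) true = 1 by exact: IH.
elim: n s => [|n IH] s sU /=.
  by rewrite asboolT ?eqxx //; exists U.
rewrite (eq_bigr (fun=> 1)) ?mean_const // => x _.
by rewrite IH //= sU andbT; apply/eqP; exact: fU.
Qed.

Definition close_prob (delta : R) f h : R :=
  #|gT|%:R^-1 * \sum_(x : gT) (frobenius (\val (f x) - \val (h x)) <= delta)%R%:R.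

Lemma close_prob_ge0 delta f h : 0 <= close_prob delta f h.
Proof. by rewrite mulr_ge0 ?invr_ge0 ?ler0n ?sumr_ge0. Qed.

(* Union bound over a family [h] that covers the conjugates of [g] up to [delta]. *)
Lemma consistency_test_accept_le f g (I : finType) (h : I -> gT -> frobball R d)
    (delta : R) n :
    (forall U : 'M[R[i]]_d, U \is unitarymx -> exists c, forall x,
      frobenius (U *m g x *m invmx U - \val (h c x)) <= delta) ->
  prob_output f (consistency_test g n [::]) true
    <= \sum_c close_prob delta f (h c) ^+ n.
Proof.
move=> cover.
pose close c x := frobenius (\val (f x) - \val (h c x)) <= delta.
(* Generalisation to a test that has already seen the points of [t]: only those [c] that are close
   to [f] at all of them still contribute. *)
suff IH (t : seq gT) :
    prob_output f (consistency_test g n [seq (x, f x) | x <- t]) true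
      <= \sum_c (all (close c) t)%:R * close_prob delta f (h c) ^+ n.
  by have := IH [::]; under eq_bigr do rewrite mul1r.
elim: n t => [|n IH] t /=.
  case: asboolP => [[U Uu]|_]; last first.
    by rewrite sumr_ge0 // => c _; rewrite mulr1 ler0n.
  (* The member of the family near the explaining [U] is close to [f] on all of [t], so its term
     alone equals 1. *)
  rewrite all_map => /allP /= tU; have [c Uc] := cover U Uu.
  rewrite (bigD1 c) //= expr0 mulr1 (_ : all _ _ = true).
    by rewrite lerDl sumr_ge0 // => ? _; rewrite mulr1 ler0n.
  by apply/allP => x /tU /eqP xU; have := Uc x; rewrite -xU.
have -> : \sum_c (all (close c) t)%:R * close_prob delta f (h c) ^+ n.+1 =
    #|gT|%:R^-1 * \sum_x \sum_c (all (close c) (x :: t))%:R *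
      close_prob delta f (h c) ^+ n.
  (* Averaging the indicator of closeness over the fresh point [x] produces one factor
     [close_prob]. *)
  rewrite exchange_big mulr_sumr; apply: eq_bigr => c _ /=.
  rewrite -mulr_suml exprS !mulrA; congr (_ * _).
  rewrite -mulrA mulrCA; congr (_ * _); rewrite mulr_sumr.
  by apply: eq_bigr => x _; rewrite -natrM mulnb andbC.
rewrite ler_pM2l ?invr_gt0 ?lt0r ?card_finGroup_neq0 ?ler0n //.
by apply: ler_sum => x _; exact: (IH (x :: t)).
Qed.

Lemma frobball_le1 (A : frobball R d) : frobenius A <= 1.
Proof. exact: (valP A). Qed.

Lemma frobball_dist_sqr_le4 (A B : frobball R d) :
  frobenius (\val A - \val B) ^+ 2 <= 4.
Proof.
apply: le_trans (frobenius_sqr_sub_le _ _ _ _) _.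
have sqr1 (C : frobball R d) : frobenius C ^+ 2 <= 1.
  by rewrite expr_le1 ?frobenius_ge0 ?frobball_le1.
by have := sqr1 A; have := sqr1 B; lra.
Qed.

Lemma sqr_dist f h :
  dist f h ^+ 2 =
    4^-1 * (#|gT|%:R^-1 * \sum_(x : gT) frobenius (\val (f x) - \val (h x)) ^+ 2).
Proof.
rewrite /dist exprMn sqr_sqrtr ?mulr_ge0 ?invr_ge0 ?ler0n ?sumr_ge0 //.
  by rewrite exprVn -natrX.
by move=> x _; exact: sqr_ge0.
Qed.

Lemma dist_le1 f h : dist f h <= 1.
Proof.
have d0 : 0 <= dist f h by rewrite mulr_ge0 ?invr_ge0 ?sqrtr_ge0.
rewrite -(expr_le1 (n := 2)) // sqr_dist ler_pdivrMl // mulr1.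
rewrite -[leRHS]mean_const ler_wpM2l ?invr_ge0 ?ler0n //.
by apply: ler_sum => x _; exact: frobball_dist_sqr_le4.
Qed.

(** In the mean of the squared distances, close points contribute at most [delta ^ 2] and the others
    at most 4, the squared diameter of the ball. The factor one half in [dist] makes this mean at
    least [4 * eps ^ 2]. *)
Lemma close_prob_le (eps delta : R) f h :
  0 <= eps -> 0 <= delta -> eps <= dist f h ->
  close_prob delta f h <= 1 - (eps ^+ 2 - delta ^+ 2 / 4).
Proof.
move=> e0 d0 eps_le.
have : eps ^+ 2 <= dist f h ^+ 2 by rewrite ler_sqr ?nnegrE // (le_trans e0).
rewrite sqr_dist => le_eps.
suff : #|gT|%:R^-1 * \sum_(x : gT) frobenius (\val (f x) - \val (h x)) ^+ 2
    <= delta ^+ 2 + 4 * (1 - close_prob delta f h) by lra.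
rewrite -[delta ^+ 2]mean_const -[X in X - close_prob _ _ _]mean_const.
rewrite /close_prob -mulrBr mulrCA -mulrDr -sumrB [4 * _]mulr_sumr -big_split.
rewrite ler_wpM2l ?invr_ge0 ?ler0n //; apply: ler_sum => x _ /=.
have [le_d|_] := boolP (frobenius (\val (f x) - \val (h x)) <= delta) => /=;
  rewrite ?subrr ?mulr0 ?addr0 ?subr0 ?mulr1.
  by rewrite ler_sqr ?nnegrE ?frobenius_ge0.
by rewrite (le_trans (frobball_dist_sqr_le4 _ _)) // lerDr sqr_ge0.
Qed.

(** A Bernoulli-type bound that replaces the exponential estimate. The induction rests on [(1 - p)
    (1 + (n + 1) p) = 1 + n p - (n + 1) p ^ 2]. *)
Lemma exprn_1sub_le (p : R) n :
  0 <= p <= 1 -> (1 - p) ^+ n * (1 + n%:R * p) <= 1.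
Proof.
move=> /andP[p0 p1]; elim: n => [|n IH]; first by rewrite expr0 mul0r addr0 mulr1.
apply: le_trans IH; rewrite exprSr -mulrA ler_wpM2l ?exprn_ge0 ?subr_ge0 //.
rewrite -natr1; have : 0 <= n%:R :> R by []; set m := n%:R => m0.
have := mulr_ge0 m0 (sqr_ge0 p); have := sqr_ge0 p; nra.
Qed.

(** The members of the family are themselves conjugates of [g], so farness applies to each of them
    and every term of the union bound is at most [(1 - p) ^ n]. *)
Lemma consistency_test_sound f g (I : finType) (h : I -> gT -> frobball R d)
    (eps delta : R) n (p := eps ^+ 2 - delta ^+ 2 / 4) :
    0 <= eps -> 0 <= delta -> 0 <= p ->
    (forall U : 'M[R[i]]_d, U \is unitarymx -> exists c, forall x,
      frobenius (U *m g x *m invmx U - \val (h c x)) <= delta) ->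
    (forall c, unitarily_equivalent g (h c)) ->
    far eps f (unitarily_equivalent g) ->
    #|I|%:R * (1 - p) ^+ n <= 3^-1 ->
  2 / 3 <= prob_output f (consistency_test g n [::]) false.
Proof.
move=> e0 d0 p0 cover equiv f_far In.
have : prob_output f (consistency_test g n [::]) true <= 3^-1.
  apply: le_trans (consistency_test_accept_le f g _ h delta n cover) _.
  apply: le_trans In; rewrite mulr_natl -sumr_const.
  apply: ler_sum => c _; apply: lerXn2r; rewrite ?nnegrE ?close_prob_ge0 //.
    by rewrite (le_trans (close_prob_ge0 delta f (h c))) // close_prob_le // f_far.
  by rewrite close_prob_le // f_far.
have := prob_outputC f (consistency_test g n [::]); lra.
Qed.

Lemma unitarily_equivalent_refl g : unitarily_equivalent g g.
Proof.
exists 1%:M; first exact: unitarymx1.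
by move=> x; rewrite invmx1 mulmx1 mul1mx.
Qed.

End ConsistencyTest.

(** * A finite net of the unitary group *)

Section UnitaryNet.
Variables (R : realType) (d : nat).

Lemma unitary_conj_in_ball (g : frobball R d) (U : 'M[R[i]]_d) :
  U \is unitarymx -> frobenius (U *m g *m invmx U) <= 1.
Proof. by move=> Uu; rewrite frobenius_unitary_conj // frobball_le1. Qed.

Definition conj_ball (g : frobball R d) (U : {U : 'M[R[i]]_d | U \is unitarymx}) :=
  Frobball (unitary_conj_in_ball g (val U) (valP U)).

Lemma conj_ball_equivalent (T : finGroupType) (g : T -> frobball R d) U :
  unitarily_equivalent g (fun x => conj_ball (g x) U).
Proof. by exists (val U); first exact: valP. Qed.

(** Cells of length [1/m] on [[-1, 1]]; the endpoint 1 has index [2 m], whence [2 m + 1] values.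
    Outside this interval the index is meaningless. *)
Definition grid_index (m : nat) (x : R) : 'I_(m.*2.+1) :=
  inord (Num.truncn ((x + 1) * m%:R)).

Lemma grid_index_close m (x y : R) :
    (0 < m)%N -> `|x| <= 1 -> `|y| <= 1 -> grid_index m x = grid_index m y ->
  `|x - y| <= m%:R^-1.
Proof.
move=> m0; have m0' : 0 < m%:R :> R by rewrite ltr0n.
have idx z : `|z| <= 1 -> grid_index m z = Num.truncn ((z + 1) * m%:R) :> nat /\
    0 <= (z + 1) * m%:R.
  rewrite ler_norml => /andP[z1 z2]; have z0 : 0 <= (z + 1) * m%:R.
    by rewrite mulr_ge0 //; lra.
  split=> //; rewrite inordK // ltnS -(ler_nat R) (le_trans (y := (z + 1) * m%:R)) //.
    by rewrite truncn_le.
  by rewrite -muln2 mulnC natrM ler_pM2r //; lra.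
move=> /idx[ix x0] /idx[iy y0] /(congr1 val); rewrite /= ix iy => xy.
have /andP[] := truncn_itv x0; have /andP[] := truncn_itv y0; rewrite xy -natr1.
set t := _%:R => ty yt tx xt.
rewrite -(ler_pM2r m0') mulVf ?gt_eqF // -[X in _ * X]ger0_norm ?(ltW m0') // -normrM.
by rewrite ler_norml; apply/andP; split; lra.
Qed.

(* One unitary matrix is chosen in each nonempty cell of the grid of mesh [1/m]
   on the [2 d^2] real coordinates of a matrix. *)
Lemma unitary_net m : (0 < m)%N ->
  exists (V : {ffun 'I_d * 'I_d -> 'I_(m.*2.+1) * 'I_(m.*2.+1)} ->
              {U : 'M[R[i]]_d | U \is unitarymx}),
  forall U : 'M[R[i]]_d, U \is unitarymx ->
    exists c, forall i j, normc (U i j - val (V c) i j) <= m%:R^-1 *+ 2.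
Proof.
move=> m0.
pose cell (U : 'M[R[i]]_d) :=
  [ffun p : 'I_d * 'I_d => (grid_index m (complex.Re (U p.1 p.2)),
                            grid_index m (complex.Im (U p.1 p.2)))].
have /choice [V VP] : forall c, exists V : {U : 'M[R[i]]_d | U \is unitarymx},
    forall U : 'M[R[i]]_d, U \is unitarymx -> cell U = c -> cell (val V) = c.
  move=> c; have [[U Uu Uc]|none] :=
    pselect (exists2 U : 'M[R[i]]_d, U \is unitarymx & cell U = c).
    by exists (exist (fun U => U \is unitarymx) U Uu).
  (* A cell without unitary matrices receives the identity as a dummy value. *)
  exists (exist (fun U => U \is unitarymx) 1%:M (unitarymx1 _ _)) => U Uu Uc.
  by case: none; exists U.
exists V => U Uu; exists (cell U) => i j.
have /ffunP /(_ (i, j)) := VP _ U Uu erefl; rewrite !ffunE /= => -[eqRe eqIm].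
have Re1 W : W \is unitarymx -> `|complex.Re (W i j : R[i])| <= 1.
  by move=> Wu; rewrite (le_trans (normc_Re_le _ _)) // unitarymx_entry_le1.
have Im1 W : W \is unitarymx -> `|complex.Im (W i j : R[i])| <= 1.
  by move=> Wu; rewrite (le_trans (normc_Im_le _ _)) // unitarymx_entry_le1.
apply: le_trans (normc_le_Re_Im _ _) _; rewrite mulr2n !raddfB.
by rewrite lerD // grid_index_close ?Re1 ?Im1 //; exact: (valP (V _)).
Qed.

End UnitaryNet.

(** * Choice of the number of samples, and the tester *)

Lemma dim1_unitary_conj (R : realType) (A U : 'M[R[i]]_1) :
  U \is unitarymx -> U *m A *m invmx U = A.
Proof.
move=> /unitarymx_unit Uu; rewrite [A]mx11_scalar scalar_mxC.
by rewrite -mulmxA mulmxV // mulmx1.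
Qed.

(** A number of samples linear in the size [N] of the net, rather than logarithmic, is affordable:
    it only affects the constant in the exponent. *)
Lemma pow_mul_exprn_1sub_le (R : realType) (N p : R) n :
  0 <= N -> 0 <= p <= 1 -> 3 * N <= 1 + n%:R * p -> N * (1 - p) ^+ n <= 3^-1.
Proof.
move=> N0 p01 Nn; have := exprn_1sub_le _ _ n p01; have /andP[p0 p1] := p01.
have : 0 <= (1 - p) ^+ n by rewrite exprn_ge0 // subr_ge0.
set q := (1 - p) ^+ n => q0; nra.
Qed.

Lemma consistency_test_dim1 (R : realType) (gT : finGroupType)
    (g : gT -> frobball R 1) (eps : R) :
    0 < eps <= 1 ->
  exists2 n : nat, n%:R <= eps^-1 ^+ 16 &
    forall f, far eps f (unitarily_equivalent g) ->
      2 / 3 <= prob_output f (consistency_test R _ gT g n [::]) false.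
Proof.
move=> /andP[e0 e1].
have e2_le1 : eps ^+ 2 <= 1 by rewrite expr_le1 // ltW.
have sound n : #|{: unit}|%:R * (1 - eps ^+ 2) ^+ n <= 3^-1 ->
    forall f, far eps f (unitarily_equivalent g) ->
      2 / 3 <= prob_output f (consistency_test R _ gT g n [::]) false.
  move=> n3 f f_far.
  apply: (@consistency_test_sound _ _ _ f g unit (fun=> g) eps 0 n) => //.
  - exact: ltW.
  - by rewrite expr0n mul0r subr0 exprn_ge0 // ltW.
  - move=> U Uu; exists tt => x; rewrite dim1_unitary_conj // subrr.
    by rewrite /frobenius big1 ?sqrtr0 // => i _; rewrite big1 // => j _;
      rewrite mxE ComplexField.Normc.normc0 expr0n.
  - by move=> _; exact: unitarily_equivalent_refl.
  - by rewrite expr0n mul0r subr0.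
have e2_gt0 : 0 < eps ^+ 2 by rewrite exprn_gt0.
(* For [eps] near 1 the bound on the number of queries is below 2, so that a
   single query must suffice. *)
have [large|small] := leP (2 / 3) (eps ^+ 2).
  exists 1%N; first by rewrite exprn_ege1 // invf_ge1.
  by apply: sound; rewrite card_unit expr1; lra.
pose y := (eps ^+ 2)^-1; have y_gt : 3 / 2 < y.
  by rewrite -[3 / 2]invrK ltf_pV2 ?posrE //; lra.
(* With [p = 1 / y] and [N = 1], any [n >= 2 y] gives [1 + n p >= 3]. The allowed number of queries
   is [y ^ 8], which exceeds [2 y + 1] since [y > 3 / 2]. *)
exists (Num.truncn (2 * y)).+1.
  have : (Num.truncn (2 * y))%:R <= 2 * y by rewrite truncn_le; lra.
  rewrite -natr1 (_ : 16 = 2 * 8)%N // exprM exprVn -/y => le_t.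
  apply: (@le_trans _ _ (2 * y + 1)); first by lra.
  have y2 : 3 / 2 * y <= y ^+ 2 by nra.
  have y4 : 3 * y <= y ^+ 4 by rewrite (_ : 4 = 2 * 2)%N // exprM; nra.
  by rewrite (_ : 8 = 4 * 2)%N // exprM; nra.
apply: sound; apply: pow_mul_exprn_1sub_le.
- by rewrite card_unit.
- by rewrite ltW.
rewrite card_unit mulr1 -lerBlDl.
have /ltW := truncnS_gt (2 * y); rewrite -(ler_pM2r e2_gt0) -mulrA mulVf ?gt_eqF //.
lra.
Qed.

Lemma consistency_test_dim_ge2 (R : realType) (gT : finGroupType) (d : nat)
    (g : gT -> frobball R d) (eps : R) (B := d%:R `^ (3 / 2) / eps) :
    (1 < d)%N -> 0 < eps <= 1 ->
  exists2 n : nat, n%:R <= B ^+ (16 * d ^ 2) &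
    forall f, far eps f (unitarily_equivalent g) ->
      2 / 3 <= prob_output f (consistency_test R _ gT g n [::]) false.
Proof.
move=> d1 /andP[e0 e1].
have e2_gt0 : 0 < eps ^+ 2 by rewrite exprn_gt0.
have e2_le1 : eps ^+ 2 <= 1 by rewrite expr_le1 // ltW.
have d2 : 2 <= d%:R :> R by rewrite ler_nat.
have d3_ge0 : 0 <= d%:R ^+ 3 :> R by rewrite exprn_ge0.
have B2E : B ^+ 2 = d%:R ^+ 3 / eps ^+ 2.
  rewrite exprMn exprVn -[_ `^ _ ^+ 2]powR_mulrn ?powR_ge0 // -powRrM.
  rewrite divfK ?pnatr_eq0 //.
  by rewrite powR_mulrn.
(* Since [d >= 2] and [eps <= 1], [B ^ 2] is at least 8. From here on numerical constants are
   absorbed into powers of [B]. *)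
have B_ge2 : 2 <= B.
  rewrite -ler_sqr ?nnegrE ?mulr_ge0 ?powR_ge0 ?invr_ge0 ?(ltW e0) // B2E.
  rewrite ler_pdivlMr //.
  have : 2 ^+ 3 <= d%:R ^+ 3 :> R by rewrite lerXn2r ?nnegrE.
  nra.
have B_ge1 : 1 <= B by lra.
(* The net has entrywise precision [2 / m], so conjugates move by at most [4 d ^ 3 / m], which this
   mesh makes at most [eps]. *)
pose m := (Num.truncn (4 * d%:R ^+ 3 / eps)).+1.
have m_gt : 4 * d%:R ^+ 3 / eps < m%:R by exact: truncnS_gt.
have m_gt0 : 0 < m%:R :> R by rewrite ltr0n.
have m_le : m%:R <= 4 * B ^+ 2 + 1.
  rewrite -[leLHS]natr1 lerD2r (le_trans (y := 4 * d%:R ^+ 3 / eps)) //.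
    by rewrite truncn_le divr_ge0 ?mulr_ge0 // ltW.
  rewrite B2E -mulrA ler_pM2l // ler_pM2l ?exprn_gt0 ?ltr0n ?(ltnW d1) //.
  rewrite lef_pV2 ?posrE //.
  by rewrite expr2 ler_piMr // ltW.
have [V VP] := @unitary_net R d m isT.
pose I := {ffun 'I_d * 'I_d -> 'I_(m.*2.+1) * 'I_(m.*2.+1)}.
have cardI : #|{: I}|%:R <= B ^+ (12 * d ^ 2).
  rewrite card_ffun !card_prod !card_ord (mulnn m.*2.+1) -expnM natrX.
  have B4 : 4 <= B ^+ 2 by nra.
  (* [2 m + 1 <= 8 B ^ 2 + 3 <= 11 B ^ 2], and [11 <= B ^ 4]. *)
  have k_le : (m.*2.+1)%:R <= B ^+ 6.
    rewrite -natr1 -muln2 natrM (_ : 6 = 2 * 3)%N // exprM.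
    apply: le_trans (_ : 11 * B ^+ 2 <= _); first by lra.
    rewrite exprS mulrC ler_pM2l; [nra | lra].
  apply: le_trans (_ : (B ^+ 6) ^+ (2 * (d * d)) <= _).
    by rewrite lerXn2r ?nnegrE // exprn_ge0 //; lra.
  by rewrite -exprM mulnA mulnn.
set N := #|{: I}|%:R in cardI.
pose p := eps ^+ 2 - eps ^+ 2 / 4.
have p_gt0 : 0 < p by rewrite /p; lra.
(* As [p = 3 eps ^ 2 / 4], the untruncated value times [p] is [3 N]. Truncation loses less than 1
   sample, hence at most [p <= 1], which the 1 in [1 + n p] makes up for. *)
exists (Num.truncn (4 * N / eps ^+ 2)).
  apply: le_trans (_ : 4 * N / eps ^+ 2 <= _).
    by rewrite truncn_le divr_ge0 ?(ltW e2_gt0) // mulr_ge0 // ler0n.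
  apply: le_trans (_ : B ^+ (12 * d ^ 2) * B ^+ 4 <= _); last first.
    rewrite -exprD ler_weXn2l // (_ : 16 = 12 + 4)%N // mulnDl leq_add2l.
    by rewrite leq_pmulr // expn_gt0 (ltnW d1).
  rewrite mulrAC mulrC ler_pM ?divr_ge0 ?ler0n ?(ltW e2_gt0) //.
  rewrite (_ : B ^+ 4 = B ^+ 2 * B ^+ 2); last by rewrite -exprD.
  rewrite ler_pM ?invr_ge0 ?(ltW e2_gt0) //; first by nra.
  by rewrite B2E ler_peMl ?invr_ge0 ?(ltW e2_gt0) // exprn_ege1 //; lra.
move=> f f_far.
apply: (@consistency_test_sound _ _ _ f g I
  (fun c x => conj_ball R d (g x) (V c)) eps eps) => //;
  rewrite ?(ltW e0) ?(ltW p_gt0) //.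
- move=> U Uu; have [c Uc] := VP U Uu; exists c => x.
  apply: le_trans (@frobenius_conj_dist R d _ _ _ _ _ Uu (valP (V c)) _ Uc) _.
  + exact: frobball_le1.
  + by rewrite mulrn_wge0 // invr_ge0.
  have -> : d%:R ^+ 3 * (m%:R^-1 *+ 2 *+ 2) = 4 * d%:R ^+ 3 / m%:R :> R by ring.
  by rewrite ler_pdivrMr // [leRHS]mulrC -ler_pdivrMr // ltW.
- by move=> c; exact: conj_ball_equivalent.
apply: pow_mul_exprn_1sub_le.
- exact: ler0n.
- by rewrite (ltW p_gt0) /p; lra.
have : 4 * N / eps ^+ 2 <= 1 + (Num.truncn (4 * N / eps ^+ 2))%:R.
  by rewrite addrC natr1 ltW // truncnS_gt.
rewrite -(ler_pM2r p_gt0); have -> : 4 * N / eps ^+ 2 * p = 3 * N.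
  by rewrite /p; field; rewrite gt_eqF.
have p_le1 : p <= 1 by rewrite /p; lra.
by rewrite -/N -/p; lra.
Qed.

Theorem theorem6p1 (R : realType) :
  exists2 C : R, 0 < C &
  forall (gT : finGroupType) (d : nat) (g : gT -> frobball R d), (0 < d)%N ->
  exists2 T : R -> query_algorithm R d gT,
    is_tester (unitarily_equivalent g) T &
    query_complexity_le T
      (fun eps => (d%:R `^ (3 / 2) / eps) `^ (C * d%:R ^+ 2)).
Proof.
(* 12 comes from the size of the net and 4 from the factor [4 / eps ^ 2 <= B ^ 4]. *)
exists 16 => // gT d g d_gt0.
have /choice [n nP] : forall eps : R, exists n : nat, 0 < eps ->
    n%:R <= (d%:R `^ (3 / 2) / eps) `^ (16 * d%:R ^+ 2) /\
    forall f, far eps f (unitarily_equivalent g) ->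
      2 / 3 <= prob_output f (consistency_test R _ gT g n [::]) false.
  move=> eps; have [e0|] := ltP 0 eps; last by exists 0%N.
  have [e_gt1|e_le1] := ltP 1 eps.
    (* Distances never exceed 1 and [g] is equivalent to itself, so for [eps > 1] no function is far
       and no query is made. *)
    exists 0%N => _; split=> [|f f_far]; first exact: powR_ge0.
    have := lt_le_trans e_gt1 (f_far g (unitarily_equivalent_refl _ _ _ g)).
    by rewrite ltNge dist_le1.
  have -> : 16 * d%:R ^+ 2 = (16 * d ^ 2)%:R :> R by rewrite natrM natrX.
  rewrite powR_mulrn; last by rewrite divr_ge0 ?powR_ge0 // ltW.
  have e01 : 0 < eps <= 1 by rewrite e0.
  case: d d_gt0 g => [|[|d]] // _ g.
    have [n n_le n_far] := @consistency_test_dim1 R gT g eps e01.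
    by exists n; rewrite powR1 div1r exp1n muln1.
  by have [n n_le n_far] := @consistency_test_dim_ge2 R gT d.+2 g eps isT e01; exists n.
exists (fun eps => consistency_test R d gT g (n eps) [::]) => eps e0.
  split=> [f gf|f f_far]; last by have [_] := nP eps e0; exact.
  by rewrite (consistency_test_complete _ _ _ f) //; lra.
move=> f; have [+ _] := nP eps e0; apply: le_trans.
by rewrite ler_nat num_queries_consistency_test.
Qed.
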